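(* Let $W$ be a binary erasure channel with erasure probability $z\in[0,1]$ and capacity $I(W)=1-z$. For $\varepsilon\in(0,1)$ such that $n:=-5\log_2\varepsilon$ is a positive integer, let $\mathcal T=\mathcal T(W,\varepsilon)$ be the channel tree generated from the root $W$ by the rule: apply the channel transformation $T$ to a vertex $w$ (i.e. give $w$ the two children $w^\flat$ and $w^\sharp$) if and only if $\operatorname{depth}(w)<n$ and $Y(w)>\varepsilon 2^{-n}$; and let $\mathcal A$ be the set of leaves $w$ of $\mathcal T$ with $Z(w)\le\varepsilon2^{-n}$. Then, for all sufficiently small such $\varepsilon$ (depending on $W$), the code rate $R$ of $(\mathcal T,\mathcal A)$ satisfies $R\ge I(W)-\varepsilon$.
   Context: For a binary erasure channel $w$, let $Z(w)\in[0,1]$ denote its erasure probability (its Bhattacharyya parameter) and $Y(w)=\min\{Z(w),1-Z(w)\}$. The channel transformation $T$ turns two independent copies of $w$ into one copy of $w^\flat$ and one copy of $w^\sharp$, which are binary erasure channels with $Z(w^\flat)=1-(1-Z(w))^2$ and $Z(w^\sharp)=Z(w)^2$. A channel tree is a finite rooted full binary tree (each vertex has zero or two children) whose vertices are labelled by channels, such that the children of every non-leaf vertex $w$ are $w^\flat$ and $w^\sharp$. The root has depth $0$; $\operatorname{depth}(w)$ is the distance of $w$ from the root. Different vertices are regarded as distinct even if their labels have equal erasure probabilities. The code $(\mathcal T,\mathcal A)$ sends information bits through the copies of the leaf channels in $\mathcal A$ and fixed symbols through the copies of the other leaf channels; the circuit consumes $2^{\operatorname{depth}(\mathcal T)}$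 copies of $W$, where $\operatorname{depth}(\mathcal T)$ is the depth of the deepest leaf, and produces $2^{\operatorname{depth}(\mathcal T)-\operatorname{depth}(w)}$ copies of each leaf channel $w$. The code rate $R$ is the number of copies of leaf channels in $\mathcal A$ divided by the number of copies of $W$ consumed, i.e. $R=\sum_{w\in\mathcal A}2^{-\operatorname{depth}(w)}=\mathbb P\{K_\tau\in\mathcal A\}$, where $K_\tau$ is the random leaf reached by starting at the root and repeatedly moving to one of the two children with probability $1/2$ each until a leaf is reached. *)

(* Defs.v *)
(* MathComp-Analysis: the real numbers are an arbitrary [R : realType]. *)
From HB Require Import structures.
From mathcomp Require Import all_boot all_order all_algebra.
From mathcomp Require Import reals exp.

Set Implicit Arguments.
Unset Strict Implicit.
Unset Printing Implicit Defensive.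

Import Order.TTheory GRing.Theory Num.Theory.
Local Open Scope ring_scope.

Definition log2 (R : realType) (x : R) : R := ln x / ln 2.

(* A binary erasure channel is given by its erasure probability. *)
Record bec (R : realType) := BEC {
  Z : R;
  Z_itv : 0 <= Z <= 1
}.

Definition Y (R : realType) (w : bec R) : R := Num.min (Z w) (1 - Z w).

Definition capacity (R : realType) (w : bec R) : R := 1 - Z w.

Lemma flat_itv (R : realType) (w : bec R) : 0 <= 1 - (1 - Z w) ^+ 2 <= 1.
Proof.
have /andP[z0 z1] := Z_itv w.
by rewrite subr_ge0 exprn_ile1 ?subr_ge0 ?gerBl //= sqr_ge0.
Qed.

Lemma sharp_itv (R : realType) (w : bec R) : 0 <= Z w ^+ 2 <= 1.
Proof. by have /andP[z0 z1] := Z_itv w; rewrite sqr_ge0 exprn_ile1. Qed.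

Definition flat (R : realType) (w : bec R) : bec R := BEC (flat_itv w).
Definition sharp (R : realType) (w : bec R) : bec R := BEC (sharp_itv w).

(* Full binary trees with vertices labelled by channels. *)
Inductive ctree (R : realType) :=
| Leaf of bec R
| Node of bec R & ctree R & ctree R.

Definition label (R : realType) (t : ctree R) : bec R :=
  match t with Leaf w => w | Node w _ _ => w end.

Fixpoint depth (R : realType) (t : ctree R) : nat :=
  match t with
  | Leaf _ => 0
  | Node _ l r => (maxn (depth l) (depth r)).+1
  end.

(* A vertex is its address (the path from the root, [false] leading to the
   flat child and [true] to the sharp one) together with its label; vertices
   with the same label are thus kept distinct. *)
Definition vertex (R : realType) : Type := (seq bool * bec R)%type.

Definition vdepth (R : realType) (v : vertex R) : nat := size v.1.

Fixpoint leaves (R : realType) (t : ctree R) : seq (vertex R) :=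
  match t with
  | Leaf w => [:: ([::], w)]
  | Node _ l r => [seq (false :: v.1, v.2) | v <- leaves l]
               ++ [seq (true :: v.1, v.2) | v <- leaves r]
  end.

(* [generated rule d t]: [t], with its root placed at depth [d], is a channel
   tree in which a vertex has children if and only if it satisfies [rule]. *)
Fixpoint generated (R : realType) (rule : nat -> bec R -> bool) (d : nat)
    (t : ctree R) : Prop :=
  match t with
  | Leaf w => ~~ rule d w
  | Node w l r => [/\ rule d w, label l = flat w, label r = sharp w,
                      generated rule d.+1 l & generated rule d.+1 r]
  end.

Fixpoint grow (R : realType) (rule : nat -> bec R -> bool) (fuel d : nat)
    (w : bec R) : ctree R :=
  match fuel with
  | 0 => Leaf w
  | k.+1 => if rule d w
            then Node w (grow rule k d.+1 (flat w)) (grow rule k d.+1 (sharp w))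
            else Leaf w
  end.

Definition threshold (R : realType) (eps : R) (n : nat) : R := eps * 2 ^- n.

Definition apply_rule (R : realType) (eps : R) (n d : nat) (w : bec R) : bool :=
  (d < n)%N && (threshold eps n < Y w).

(* The rule never applies at depth [n], so the fuel [n] does not truncate the
   construction: see [channel_treeP]. *)
Definition channel_tree (R : realType) (W : bec R) (eps : R) (n : nat) :
    ctree R := grow (apply_rule eps n) n 0 W.

Lemma label_grow (R : realType) (rule : nat -> bec R -> bool) (k d : nat)
  (w : bec R) : label (grow rule k d w) = w.
Proof. by case: k => //= k; case: ifP. Qed.

Lemma channel_treeP (R : realType) (W : bec R) (eps : R) (n : nat)
    (t : ctree R) :
  t = channel_tree W eps n <->
  label t = W /\ generated (apply_rule eps n) 0 t.
Proof.
suff H k d w u : (d + k = n)%N ->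
    u = grow (apply_rule eps n) k d w <->
    label u = w /\ generated (apply_rule eps n) d u by exact: (H n 0%N).
elim: k d w u => [|k IH] d w u dk.
  have nr v : apply_rule eps n d v = false.
    by rewrite /apply_rule -dk addn0 ltnn.
  by split=> [->|[]] /=; [rewrite nr | case: u => [v /= ->|v l r _ /= []];
     rewrite ?nr].
have dk' : (d.+1 + k = n)%N by rewrite addSnnS.
split=> [->|[]] /=.
  case: ifP => /= [rw|->//]; split=> //.
  have G v : generated (apply_rule eps n) d.+1
                       (grow (apply_rule eps n) k d.+1 v).
    by have [/(_ erefl)[]] := IH d.+1 v (grow (apply_rule eps n) k d.+1 v) dk'.
  by split; rewrite ?label_grow.
case: u => [v /= -> /negbTE ->//|v l r /= -> [-> ll lr gl gr]].
by congr Node; apply/(IH _ _ _ dk').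
Qed.

(* Sets of leaves are predicates on vertices, evaluated on the leaves only. *)
Definition info_set (R : realType) (eps : R) (n : nat) : pred (vertex R) :=
  fun v => Z v.2 <= threshold eps n.

(* Number of copies of the leaf channels in [A] divided by the number of
   copies of the root channel consumed. *)
Definition code_rate (R : realType) (t : ctree R) (A : pred (vertex R)) : R :=
  (\sum_(v <- leaves t | A v) 2 ^ (depth t - vdepth v))%N%:R
  / (2 ^ depth t)%N%:R.

(* Main.v *)
(* Z is a martingale along the random walk down the tree, so I(W) is the mean
   of 1 - Z at the random leaf.  There 1 - Z <= 1 on A and 1 - Z <= theta when
   Z >= 1 - theta, hence R >= I(W) - theta - P(C), where theta = eps 2^-n and C
   is the event that theta < Z < 1 - theta at depth n.
   P(C) is controlled by the potential h = sqrt(Z(1 - Z)) + c / (1 - ln Y), c > 0.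
   The first term contracts on average by sqrt 3 / 2 < 0.87 at every step.
   The second one contracts by 0.87 when Y is small, since squaring Y nearly
   halves 1 / (1 - ln Y) while doubling Y hardly changes it; elsewhere it is
   bounded, hence absorbed by the first term if c is small.  On C the potential
   is at least of order 1/n, so P(C) = O(n 0.87^n), which is below eps / 2
   because 0.87^5 < 1/2 = eps^(5/n). *)
Require Import Defs.
From HB Require Import structures.
From mathcomp Require Import all_boot all_order all_algebra.
From mathcomp Require Import reals sequences exp.
From mathcomp Require Import ring lra.

Import Order.TTheory GRing.Theory Num.Theory.
Local Open Scope ring_scope.

(** * Code rate as a random-walk probability *)

Section CodeRate.
Variable R : realType.
Implicit Types (t : ctree R) (P : pred (bec R)).

Fixpoint leaf_prob P t : R :=
  match t with
  | Leaf w => (P w)%:R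
  | Node _ l r => (leaf_prob P l + leaf_prob P r) / 2
  end.

(** Letting [D] exceed the depth makes the induction work: both subtrees are counted against the
    same [D], even when their depths differ. *)
Lemma sum_leavesE P t (D : nat) : (depth t <= D)%N ->
  (\sum_(v <- leaves t | P v.2) 2 ^ (D - vdepth v))%N%:R
    = 2 ^+ D * leaf_prob P t.
Proof.
elim: t D => [w|w l IHl r IHr] D /=.
  rewrite big_mkcond big_seq1 /= subn0.
  by case: (P w); rewrite ?mulr1 ?mulr0 ?natrX.
case: D => [//|D]; rewrite ltnS geq_max => /andP[lD rD].
rewrite big_cat /= !big_map natrD.
under eq_bigr => v _ do rewrite /vdepth /= subSS.
under [in X in _ + X]eq_bigr => v _ do rewrite /vdepth /= subSS.
by rewrite IHl // IHr // exprS; lra.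
Qed.

Lemma code_rateE P t : code_rate t (fun v => P v.2) = leaf_prob P t.
Proof.
rewrite /code_rate sum_leavesE // natrX mulrC mulKf //.
by rewrite expf_neq0 ?pnatr_eq0.
Qed.

End CodeRate.

(** * Average contraction of the potential *)

Section Potential.
Variable R : realType.
Implicit Types (w : bec R) (x y : R).

Lemma Y_ge0 w : 0 <= Y w.
Proof. by have /andP[z0 z1] := Z_itv w; rewrite le_min z0 subr_ge0. Qed.

Lemma Y_le_half w : Y w <= 1 / 2.
Proof. by rewrite ge_min; case: (lerP (Z w) (1 / 2)) => //= ?; lra. Qed.

(** Exchanging [Z] with [1 - Z] swaps the two children; the case depends on which side of 1/2 [Z]
    lies. *)
Lemma Y_children w : (Y (flat w) <= 2 * Y w /\ Y (sharp w) <= Y w ^+ 2) \/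
  (Y (sharp w) <= 2 * Y w /\ Y (flat w) <= Y w ^+ 2).
Proof.
have /andP[z0 z1] := Z_itv w; rewrite /Y /=; set z := Z w in z0 z1 *.
have [zz|zz] := leP z (1 - z); [left|right]; split; rewrite ge_min; apply/orP;
  by (left; nra) || (right; nra).
Qed.

(** [ln] takes the default value 0 at 0, so [logweight 0] is 1 and monotonicity of [logweight]
    requires positive arguments. *)
Lemma Y_children_gt0 w : 0 < Y w -> 0 < Y (flat w) /\ 0 < Y (sharp w).
Proof. by rewrite /Y !lt_min /= => /andP[z0 z1]; split; apply/andP; split; nra. Qed.

Definition spread w : R := Num.sqrt (Z w * (1 - Z w)).

Lemma spread_le1 w : spread w <= 1.
Proof.
have /andP[z0 z1] := Z_itv w.
by rewrite -(sqrtr1 R) ler_wsqrtr //; nra.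
Qed.

Lemma spread_ge0 w : 0 <= spread w.
Proof. exact: sqrtr_ge0. Qed.

Lemma sqr_spread w : spread w ^+ 2 = Z w * (1 - Z w).
Proof. by have /andP[z0 z1] := Z_itv w; rewrite sqr_sqrtr // mulr_ge0 // subr_ge0. Qed.

Lemma Y_le_spread w : Y w <= spread w.
Proof.
rewrite -[_ <= _]ler_sqr ?nnegrE ?Y_ge0 ?spread_ge0 // sqr_spread.
have /andP[z0 z1] := Z_itv w; rewrite /Y.
case: (leP (Z w) (1 - Z w)) => zz; first by rewrite expr2 ler_wpM2l.
by rewrite expr2 ler_wpM2r ?subr_ge0 // ltW.
Qed.

(* The sharp factor is sqrt 3. *)
Lemma spread_children w :
  spread (flat w) + spread (sharp w) <= 1733 / 1000 * spread w.
Proof.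
have /andP[z0 z1] := Z_itv w.
have a0 := spread_ge0 (flat w); have b0 := spread_ge0 (sharp w).
have s0 := spread_ge0 w.
have := sqr_spread (flat w); have := sqr_spread (sharp w).
have := sqr_spread w; rewrite /=.
move: (spread (flat w)) (spread (sharp w)) (spread w) (Z w) => a b s z in
  z0 z1 a0 b0 s0 * => ss bb aa.
set u := z * (1 - z) in ss.
have u0 : 0 <= u by rewrite mulr_ge0 // subr_ge0.
have u4 : 4 * u <= 1 by have := sqr_ge0 (1 - 2 * z); rewrite /u; nra.
have sum2 : a ^+ 2 + b ^+ 2 = u * (2 - 2 * u) by rewrite aa bb /u; ring.
have prod2 : (2 * (a * b)) ^+ 2 = u ^+ 2 * (4 * u * (2 + u)).
  by rewrite !exprMn aa bb /u; ring.
(* This holds since (1 + 2u)^2 - 4u(2 + u) = 1 - 4u >= 0. With [sum2] it gives (a + b)^2 <= u(2 -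
   2u) + u(1 + 2u) = 3u. *)
have prod : 2 * (a * b) <= u * (1 + 2 * u).
  rewrite -[_ <= _]ler_sqr ?nnegrE; [|nra|nra].
  by rewrite prod2 [(u * _) ^+ 2]exprMn ler_wpM2l ?sqr_ge0 //; nra.
rewrite -[_ <= _]ler_sqr ?nnegrE; [|lra|nra].
by rewrite exprMn ss; nra.
Qed.

Definition logweight y : R := (1 - ln y)^-1.

Lemma logweight_ge0 y : y <= 1 -> 0 <= logweight y.
Proof. by move=> /ln_le0 ?; rewrite invr_ge0; lra. Qed.

Lemma logweight_le1 y : y <= 1 -> logweight y <= 1.
Proof. by move=> /ln_le0 ?; rewrite invf_le1; lra. Qed.

Lemma ler_logweight x y : 0 < x -> x <= y -> y <= 1 -> logweight x <= logweight y.
Proof.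
move=> x0 xy y1; have y0 : 0 < y by exact: lt_le_trans xy.
have lny := ln_le0 y1.
have lnxy : ln x <= ln y by rewrite ler_ln ?posrE.
by rewrite lef_pV2 ?posrE; lra.
Qed.

Lemma ln2_gt0 : 0 < ln 2 :> R.
Proof. by rewrite ln_gt0 // ltr1n. Qed.

Lemma ln2_le1 : ln 2 <= 1 :> R.
Proof. by apply: (@le_ln1Dx R 1); lra. Qed.

Lemma logweight_contract y : 0 < y -> y <= expR (- 9) ->
  logweight (2 * y) + logweight (y ^+ 2) <= 174 / 100 * logweight y.
Proof.
move=> y0 y9.
have : ln y <= - 9 by rewrite -(expRK (- 9 : R)) ler_ln ?posrE ?expR_gt0.
rewrite /logweight lnM ?posrE // lnXn //.
move: (ln y) ln2_gt0 ln2_le1 => L l0 l1 L9; rewrite mulr2n.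
set M := 1 - L; have M10 : 10 <= M by rewrite /M; lra.
have -> : 1 - (ln 2 + L) = M - ln 2 by rewrite /M; ring.
have -> : 1 - (L + L) = 2 * M - 1 by rewrite /M; ring.
(* From M >= 10 follow M - ln 2 >= 9M/10 and 2M - 1 >= 19M/10; and 10/9 + 10/19 < 1.74. *)
have le1 : (M - ln 2)^-1 <= (10 / 9) * M^-1.
  rewrite -[10 / 9]invrK -invfM lef_pV2 ?posrE; lra.
have le2 : (2 * M - 1)^-1 <= (10 / 19) * M^-1.
  rewrite -[10 / 19]invrK -invfM lef_pV2 ?posrE; lra.
have : 0 <= M^-1 by rewrite invr_ge0; lra.
by lra.
Qed.

(* 7/2000 = (1.74 - 1.733) / 2, and expR (- 9) is the bound on Y below which
   [logweight] contracts. *)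
Definition mixing : R := 7 / 2000 * expR (- 9).

Lemma mixing_gt0 : 0 < mixing.
Proof. by rewrite mulr_gt0 ?expR_gt0 //; lra. Qed.

Lemma mixing_le1 : mixing <= 1.
Proof.
have : expR (- 9) <= 1 :> R by rewrite -[leRHS]expR0 ler_expR; lra.
by rewrite /mixing; lra.
Qed.

Definition potential w : R := spread w + mixing * logweight (Y w).

Lemma Y_le1 w : Y w <= 1.
Proof. by have := Y_le_half w; lra. Qed.

Lemma potential_ge0 w : 0 <= potential w.
Proof.
by rewrite addr_ge0 ?spread_ge0 // mulr_ge0 ?(ltW mixing_gt0) ?logweight_ge0 ?Y_le1.
Qed.

Lemma potential_le2 w : potential w <= 2.
Proof.
have := logweight_le1 _ (Y_le1 w); have := logweight_ge0 _ (Y_le1 w).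
by move: mixing_gt0 mixing_le1 (spread_le1 w); rewrite /potential; nra.
Qed.

Lemma potential_ge w y : 0 < y -> y <= Y w -> mixing * logweight y <= potential w.
Proof.
move=> y0 yY; apply: le_trans (_ : mixing * logweight (Y w) <= _).
  by rewrite ler_wpM2l ?(ltW mixing_gt0) // ler_logweight // Y_le1.
by rewrite lerDr spread_ge0.
Qed.

Lemma potential_children w : 0 < Y w ->
  potential (flat w) + potential (sharp w) <= 2 * (87 / 100) * potential w.
Proof.
move=> y0; have [f0 s0] := Y_children_gt0 _ y0.
have Yh := Y_le_half w; have sw := spread_children w.
have g0 := logweight_ge0 _ (Y_le1 w).
(* 7/1000 = 1.74 - 1.733 is the slack left by [spread_children]. *)
suff : mixing * (logweight (Y (flat w)) + logweight (Y (sharp w)))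
    <= 7 / 1000 * spread w + 174 / 100 * (mixing * logweight (Y w)).
  by rewrite /potential; lra.
have [small|large] := leP (Y w) (expR (- 9)).
  apply: (@le_trans _ _ (mixing * (174 / 100 * logweight (Y w)))).
    rewrite ler_wpM2l ?(ltW mixing_gt0) //.
    apply: le_trans (logweight_contract _ y0 small).
    have Yd1 : 2 * Y w <= 1 by lra.
    have Ys1 : Y w ^+ 2 <= 1 by rewrite exprn_ile1 ?Y_ge0 ?Y_le1.
    by have [[? ?]|[? ?]] := Y_children w; [|rewrite addrC];
      apply: lerD; apply: ler_logweight.
  by have := spread_ge0 w; lra.
have f1 := logweight_le1 _ (Y_le1 (flat w)).
have s1 := logweight_le1 _ (Y_le1 (sharp w)).
have Ys := Y_le_spread w; have := mulr_ge0 (ltW mixing_gt0) g0.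
(* Here [mixing * 2] is [7 / 1000 * expR (- 9)], and [expR (- 9) < Y w <= spread w]. *)
have le2 : mixing * (logweight (Y (flat w)) + logweight (Y (sharp w))) <= mixing * 2.
  by rewrite ler_wpM2l ?(ltW mixing_gt0) //; lra.
by rewrite /mixing in le2 *; lra.
Qed.

End Potential.

(** * The rate bound *)

Section Rate.
Variable R : realType.
Implicit Types (w : bec R) (eps : R).

(** Induction on the number [k] of steps left: over the two children [Z] averages to its parent
    value, and the loss term to at most its parent value. *)
Lemma leaf_prob_grow eps n k d w :
  0 < threshold eps n -> threshold eps n <= 1 -> (d + k = n)%N ->
  1 - Z w - threshold eps n
      - (mixing R * logweight R (threshold eps n))^-1
        * ((87 / 100) ^+ k * potential R w)
    <= leaf_prob R (fun u => Z u <= threshold eps n)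
         (grow (apply_rule eps n) k d w).
Proof.
set th := threshold eps n => th0 th1.
set m := mixing R * logweight R th.
have m0 : 0 < m.
  by rewrite mulr_gt0 ?mixing_gt0 // invr_gt0; have := ln_le0 th1; lra.
have loss_ge0 j u : 0 <= m^-1 * ((87 / 100) ^+ j * potential R u).
  by rewrite mulr_ge0 ?invr_ge0 ?(ltW m0) // mulr_ge0 ?potential_ge0 //
    exprn_ge0; lra.
(* If [Z u > th] then [1 - Z u <= th], which the term [- th] cancels. *)
have polarized j u : Y u <= th ->
    1 - Z u - th - m^-1 * ((87 / 100) ^+ j * potential R u)
      <= (Z u <= th)%R%:R.
  have /andP[z0 z1] := Z_itv u; have := loss_ge0 j u.
  by rewrite /Y ge_min; case: (leP (Z u) th) => /= ?; lra.
elim: k d w => [|k IH] d w dk /=.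
  have [/polarized|Yth] := leP (Y w) th; first exact.
  (* At an unpolarized leaf of depth [n] the loss is at least 1, so the lower bound is negative. *)
  have : 1 <= m^-1 * potential R w.
    by rewrite mulrC ler_pdivlMr // mul1r potential_ge // ltW.
  have /andP[z0 z1] := Z_itv w; rewrite expr0 mul1r => ?.
  by have := ler0n R (Z w <= th)%R; lra.
have -> : apply_rule eps n d w = (th < Y w).
  by rewrite /apply_rule -{1}dk addnS ltnS leq_addr.
have [Yth|Yth] := leP (Y w) th.
  exact: polarized.
have dk' : (d.+1 + k = n)%N by rewrite addSnnS.
have /= := IH _ (flat w) dk'; have /= := IH _ (sharp w) dk'.
have : m^-1 * (87 / 100) ^+ k * (potential R (flat w) + potential R (sharp w))
    <= m^-1 * (87 / 100) ^+ k * (2 * (87 / 100) * potential R w).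
  rewrite ler_wpM2l ?potential_children ?(lt_trans th0) //.
  by rewrite mulr_ge0 ?invr_ge0 ?(ltW m0) // exprn_ge0; lra.
by rewrite (exprS _ k); lra.
Qed.

Lemma Bernoulli_ineq (x : R) n : 0 <= x -> 1 + n%:R * x <= (1 + x) ^+ n.
Proof.
move=> x0; elim: n => [|n IH]; first by rewrite mul0r addr0 expr0.
rewrite exprS; apply: le_trans (_ : (1 + x) * (1 + n%:R * x) <= _); last first.
  by rewrite ler_wpM2l //; lra.
by rewrite -natr1; have := mulr_ge0 (ler0n R n) (sqr_ge0 x); lra.
Qed.

(* 0.87 (1 + 1/4000)^2 < 2^(-1/5): the slack beats any fixed power of n. *)
Lemma geometric_le : exists2 K : R, 0 <= K & forall eps n,
  0 < eps -> eps ^+ 5 = 2 ^- n -> n%:R ^+ 2 * (87 / 100) ^+ n <= K * eps.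
Proof.
exists (4000 ^+ 2) => [|eps n eps0 eps5]; first exact: sqr_ge0.
(* 1741/2000 lies between 0.87 (1 + 1/4000)^2 and 2^(-1/5). *)
have rho_eps : (1741 / 2000) ^+ n <= eps.
  rewrite -(@ler_pXn2r _ 5) ?nnegrE ?(ltW eps0) ?exprn_ge0 //; [|lra].
  rewrite eps5 -exprM mulnC exprM -exprVn.
  by apply: lerXn2r; rewrite ?nnegrE; lra.
have := @Bernoulli_ineq (1 / 4000) n ltac:(lra).
set b := (1 + _) ^+ n => bern.
have bsq : (87 / 100) ^+ n * b ^+ 2 <= (1741 / 2000) ^+ n.
  rewrite /b exprAC -exprMn; apply: lerXn2r; rewrite ?nnegrE; lra.
have n0 : 0 <= n%:R :> R by exact: ler0n.
have nb : n%:R ^+ 2 <= 4000 ^+ 2 * b ^+ 2 by nra.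
have : n%:R ^+ 2 * (87 / 100) ^+ n <= 4000 ^+ 2 * b ^+ 2 * (87 / 100) ^+ n.
  by rewrite ler_wpM2r // exprn_ge0; lra.
by lra.
Qed.

End Rate.

Theorem proposition8 (R : realType) (W : bec R) :
  exists2 eps0 : R, 0 < eps0 &
    forall (eps : R) (n : nat),
      0 < eps -> eps < 1 -> eps < eps0 ->
      (0 < n)%N -> n%:R = - 5 * log2 eps ->
      capacity W - eps
        <= code_rate (channel_tree W eps n) (info_set eps n).
Proof.
have [K K0 geo] := geometric_le R.
(* 12 = 2 * 3 * 2 comes from the target [eps / 2], the bound [3 * n] on [1 - ln th] and the bound 2
   on the potential. *)
have c0 := mixing_gt0 R; pose B := 12 * K / mixing R.
have B0 : 0 <= B by rewrite divr_ge0 ?(ltW c0) ?mulr_ge0.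
exists (expR (- B)); first exact: expR_gt0.
move=> eps n eps_gt0 eps_lt1 eps_small n_gt0 nE.
have l0 := ln2_gt0 R; have l1 := ln2_le1 R.
have n1 : 1 <= n%:R :> R by rewrite ler1n.
have lneps : 5 * ln eps = - (n%:R * ln 2).
  by rewrite nE /log2; field; rewrite gt_eqF.
have Bn : B <= n%:R.
  have : ln eps < - B by rewrite -(expRK (- B)) ltr_ln ?posrE ?expR_gt0.
  have : n%:R * ln 2 <= n%:R * 1 :> R by rewrite ler_wpM2l ?ler0n.
  by move: (B) B0 => b b0; lra.
have eps5 : eps ^+ 5 = 2 ^- n.
  apply: ln_inj; rewrite ?posrE ?invr_gt0 ?exprn_gt0 //.
  by rewrite lnV ?posrE ?exprn_gt0 // !lnXn // -[ln eps *+ 5]mulr_natl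
    -[ln 2 *+ n]mulr_natl lneps.
set th := threshold eps n.
have th0 : 0 < th by rewrite mulr_gt0 // invr_gt0 exprn_gt0.
have th_half : th <= eps / 2.
  rewrite ler_wpM2l ?(ltW eps_gt0) // lef_pV2 ?posrE ?exprn_gt0 //.
  by rewrite -[leLHS]expr1 ler_eXn2l ?ltr1n.
have th1 : th <= 1 by lra.
(* By [lneps], 1 - ln th = 1 + (6/5) n ln 2. *)
have lnth : 1 - ln th <= 3 * n%:R.
  rewrite lnM ?posrE ?invr_gt0 ?exprn_gt0 // lnV ?posrE ?exprn_gt0 // lnXn //.
  rewrite -[ln 2 *+ n]mulr_natl.
  have : n%:R * ln 2 <= n%:R * 1 :> R by rewrite ler_wpM2l ?ler0n.
  by lra.
rewrite (code_rateE R (fun u => Z u <= th)).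
have := leaf_prob_grow R eps n n 0 W th0 th1 (add0n n).
apply: le_trans; rewrite -/th /capacity.
suff : (mixing R * logweight R th)^-1 * ((87 / 100) ^+ n * potential R W)
    <= eps / 2 by lra.
rewrite invfM /logweight invrK.
have {}geo := geo _ _ eps_gt0 eps5.
have lam0 : 0 <= (87 / 100) ^+ n :> R by rewrite exprn_ge0; lra.
have p0 := potential_ge0 R W; have p2 := potential_le2 R W.
have c1 : 0 <= (mixing R)^-1 by rewrite invr_ge0 ltW.
apply: (@le_trans _ _ ((mixing R)^-1 * (3 * n%:R) * ((87 / 100) ^+ n * 2))).
  have ? : ln th <= 0 by apply: ln_le0; lra.
  by rewrite ler_pM ?mulr_ge0 ?ler_wpM2l //; lra.
have nn : 0 < n%:R :> R by lra.
(* Multiplying by [n] produces the square in [geometric_le]; the [n] gained on the right absorbs the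
   constants through [B <= n]. *)
rewrite -(ler_pM2r nn); apply: (@le_trans _ _ (6 * (mixing R)^-1 * (K * eps))).
  apply: le_trans (_ : 6 * (mixing R)^-1 * (n%:R ^+ 2 * (87 / 100) ^+ n) <= _).
    by rewrite le_eqVlt; apply/orP; left; apply/eqP; ring.
  by rewrite ler_wpM2l ?mulr_ge0.
have : eps / 2 * B <= eps / 2 * n%:R by rewrite ler_wpM2l //; lra.
by rewrite /B; lra.
Qed.
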